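(* Let $p$ be a prime, $a\in\mathbb{Q}_p$, $r\in\{p^m : m\in\mathbb{Z}\}$, and let $f:S_r(a)\to S_r(a)$ be an isometry. Then for every $x\in S_r(a)$ with $f(x)\ne x$, the sequence $(f^n(x))_{n\in\mathbb{N}}$ is not convergent.
   Context: $\mathbb{Q}_p$ is the field of $p$-adic numbers with the $p$-adic norm $|\cdot|_p$; $S_r(a)=\{x\in\mathbb{Q}_p : |x-a|_p=r\}$. An isometry is a map with $|f(x)-f(y)|_p=|x-y|_p$ for all $x,y\in S_r(a)$. $f^n$ denotes the $n$-th iterate of $f$. *)

(* Defs.v *)
From HB Require Import structures.
From mathcomp Require Import all_boot all_order all_algebra.
From mathcomp Require Import generic_quotient ring_quotient.
From mathcomp Require Import all_classical topology normedtype.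

Set Implicit Arguments.
Unset Strict Implicit.
Unset Printing Implicit Defensive.
Import Order.TTheory GRing.Theory Num.Theory.
Import numFieldNormedType.Exports.
Local Open Scope classical_set_scope.
Local Open Scope ring_scope.

(* |x|_p = p ^ - v_p(x), with v_p(n / d) = v_p(n) - v_p(d). *)
Definition padic_abs (p : nat) (x : rat) : rat :=
  if x == 0 then 0
  else p%:R ^ ((logn p `|denq x|)%:Z - (logn p `|numq x|)%:Z).

Section PadicAbs.
Variables (p : nat) (pr_p : prime p).
Local Notation abs := (padic_abs p).

Let p_gt0 : 0 < p%:R :> rat. Proof. by rewrite ltr0n prime_gt0. Qed.
Let p_gt1 : 1 < p%:R :> rat. Proof. by rewrite ltr1n prime_gt1. Qed.

Lemma padic_absE (n d : int) : n != 0 -> d != 0 ->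
  abs (n%:~R / d%:~R) = p%:R ^ ((logn p `|d|)%:Z - (logn p `|n|)%:Z).
Proof.
move=> n0 d0; set x := _ / _.
have dQ : d%:~R != 0 :> rat by rewrite intr_eq0.
have x0 : x != 0 by rewrite mulf_neq0 ?invr_eq0 ?intr_eq0.
rewrite /padic_abs (negPf x0); congr (_ ^ _).
have E : n * denq x = numq x * d.
  apply/eqP; rewrite -(eqr_int rat) !intrM numqE mulrAC /x divfK //.
have := congr1 (fun z : int => logn p `|z|) E.
rewrite !abszM !lognM ?absz_gt0 ?denq_eq0 ?numq_eq0 //.
by move=> E'; apply/eqP; rewrite subr_eq addrAC eq_sym subr_eq -!PoszD addnC -E' addnC.
Qed.

Lemma padic_abs0 : abs 0 = 0. Proof. by rewrite /padic_abs eqxx. Qed.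

Lemma padic_abs_gt0 x : (0 < abs x) = (x != 0).
Proof.
rewrite /padic_abs; case: eqVneq => [|x0] /=; first by rewrite ltxx.
by rewrite exprz_gt0.
Qed.

Lemma padic_abs_ge0 x : 0 <= abs x.
Proof.
by have [->|/=] := eqVneq x 0; [rewrite padic_abs0|rewrite -padic_abs_gt0 => /ltW].
Qed.

Lemma padic_abs1 : abs 1 = 1.
Proof. by rewrite /padic_abs oner_eq0 /= logn1 subrr expr0z. Qed.

Lemma padic_absM x y : abs (x * y) = abs x * abs y.
Proof.
have [->|x0] := eqVneq x 0; first by rewrite mul0r padic_abs0 mul0r.
have [->|y0] := eqVneq y 0; first by rewrite mulr0 padic_abs0 mulr0.
rewrite -{1}[x]divq_num_den -{1}[y]divq_num_den mulf_div -!intrM.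
rewrite padic_absE ?mulf_neq0 ?denq_eq0 ?numq_eq0 //.
rewrite /padic_abs (negPf x0) (negPf y0) !abszM !lognM ?absz_gt0 ?denq_eq0 ?numq_eq0 //.
rewrite -expfzDr ?lt0r_neq0 //; congr (_ ^ _).
by rewrite !PoszD opprD addrACA.
Qed.

Lemma padic_absN x : abs (- x) = abs x.
Proof.
rewrite /padic_abs oppr_eq0; case: eqP => // /eqP x0.
by rewrite numqN denqN abszN.
Qed.

Lemma padic_absB x y : abs (x - y) = abs (y - x).
Proof. by rewrite -padic_absN opprB. Qed.

Lemma padic_absV x : abs x^-1 = (abs x)^-1.
Proof.
have [->|x0] := eqVneq x 0; first by rewrite !(invr0, padic_abs0).
have ax0 : abs x != 0 by rewrite lt0r_neq0 // padic_abs_gt0.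
by apply: (mulfI ax0); rewrite -padic_absM divff // padic_abs1 divff.
Qed.

Lemma padic_absD x y : abs (x + y) <= Num.max (abs x) (abs y).
Proof.
have [->|x0] := eqVneq x 0; first by rewrite add0r le_max lexx orbT.
have [->|y0] := eqVneq y 0; first by rewrite addr0 le_max lexx.
have [->|xy0] := eqVneq (x + y) 0.
  by rewrite padic_abs0 le_max padic_abs_ge0.
pose n1 := numq x * denq y; pose n2 := numq y * denq x; pose d := denq x * denq y.
have d0 : d != 0 by rewrite mulf_neq0 ?denq_eq0.
have n10 : n1 != 0 by rewrite mulf_neq0 ?denq_eq0 ?numq_eq0.
have n20 : n2 != 0 by rewrite mulf_neq0 ?denq_eq0 ?numq_eq0.
have dx : (denq x)%:~R != 0 :> rat by rewrite intr_eq0 denq_eq0.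
have dy : (denq y)%:~R != 0 :> rat by rewrite intr_eq0 denq_eq0.
have Ex : x = n1%:~R / d%:~R.
  by rewrite -{1}[x]divq_num_den /n1 /d !intrM -mulf_div divff // mulr1.
have Ey : y = n2%:~R / d%:~R.
  rewrite -{1}[y]divq_num_den /n2 /d !intrM [(denq x)%:~R * _]mulrC.
  by rewrite -mulf_div divff // mulr1.
have Exy : x + y = (n1 + n2)%:~R / d%:~R by rewrite Ex Ey intrD mulrDl.
have n0 : n1 + n2 != 0.
  by apply: contraNneq xy0 => n0; rewrite Exy n0 mul0r.
rewrite Exy {1}Ex {1}Ey !padic_absE // le_max !ler_eXz2l // !lerD2l !lerN2.
rewrite !lez_nat -geq_min.
rewrite -pfactor_dvdn ?absz_gt0 //.
set m := minn _ _; rewrite -[(p ^ m)%N]/`|(p ^ m)%N%:Z|%N -dvdzE.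
by apply: rpredD; rewrite dvdzE /= pfactor_dvdn ?absz_gt0 ?geq_minl ?geq_minr.
Qed.

Lemma padic_abs_iso x y : abs (x - y) < abs y -> abs x = abs y.
Proof.
move=> xy; apply/eqP; rewrite eq_le; apply/andP; split.
  by have := padic_absD (x - y) y; rewrite subrK (max_idPr (ltW xy)).
rewrite leNgt; apply/negP => lxy.
have := padic_absD (y - x) x; rewrite subrK padic_absB le_max.
by rewrite leNgt xy leNgt lxy.
Qed.

End PadicAbs.

(* The completion of Q for |.|_p: rational Cauchy sequences modulo the ideal
   of null sequences. A primality proof is a parameter because logn p vanishes
   when p is not prime, and |.|_p is then the trivial absolute value. *)
Definition padic_cauchy (p : nat) (_ : prime p) : {pred nat -> rat} :=
  fun u => `[< forall e : rat, 0 < e -> exists N, forall m n,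
    (N <= m)%N -> (N <= n)%N -> padic_abs p (u m - u n) < e >].

Section CauchyRing.
Variables (p : nat) (pr_p : prime p).
Local Notation abs := (padic_abs p).
Local Notation cauchy := (padic_cauchy pr_p).

Lemma padic_cauchyP u : reflect (forall e : rat, 0 < e -> exists N, forall m n,
    (N <= m)%N -> (N <= n)%N -> abs (u m - u n) < e) (u \in cauchy).
Proof. exact: asboolP. Qed.

Lemma padic_cauchy_bounded u : u \in cauchy ->
  exists2 B : rat, 0 < B & exists N, forall n, (N <= n)%N -> abs (u n) <= B.
Proof.
move=> /padic_cauchyP/(_ 1 ltr01)[N uN].
exists (Num.max 1 (abs (u N))); first by rewrite lt_max ltr01.
exists N => n Nn; have := padic_absD pr_p (u n - u N) (u N); rewrite subrK.
move=> /le_trans; apply; rewrite ge_max !le_max lexx orbT andbT.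
by rewrite ltW // uN.
Qed.

Lemma padic_cauchy_subring : subring_closed cauchy.
Proof.
split.
- apply/padic_cauchyP => e e0; exists 0%N => m n _ _.
  by rewrite subrr padic_abs0.
- move=> u v /padic_cauchyP hu /padic_cauchyP hv; apply/padic_cauchyP => e e0.
  have [N uN] := hu e e0; have [M vM] := hv e e0.
  exists (maxn N M) => m n; rewrite !geq_max => /andP[? ?] /andP[? ?].
  rewrite (_ : _ - _ = (u m - u n) + (v n - v m)); last first.
    by rewrite !fctE !opprD !opprK addrACA [v n - _]addrC.
  by rewrite (le_lt_trans (padic_absD pr_p _ _)) // gt_max uN // vM.
- move=> u v hu hv; apply/padic_cauchyP => e e0.
  have [B B0 [N1 uB]] := padic_cauchy_bounded hu.
  have [C C0 [N2 vC]] := padic_cauchy_bounded hv.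
  have [N uN] := padic_cauchyP _ hu _ (divr_gt0 e0 C0).
  have [M vM] := padic_cauchyP _ hv _ (divr_gt0 e0 B0).
  exists (maxn (maxn N1 N2) (maxn N M)) => m n.
  rewrite !geq_max => /andP[/andP[? ?] /andP[? ?]] /andP[/andP[? ?] /andP[? ?]].
  rewrite (_ : _ - _ = (u m - u n) * v m + u n * (v m - v n)); last first.
    by rewrite !fctE mulrBl mulrBr addrA subrK.
  rewrite (le_lt_trans (padic_absD pr_p _ _)) // gt_max !padic_absM //.
  apply/andP; split.
    rewrite (@le_lt_trans _ _ (abs (u m - u n) * C)) //.
      by rewrite ler_wpM2l ?padic_abs_ge0 ?vC.
    by rewrite -ltr_pdivlMr // uN.
  rewrite (@le_lt_trans _ _ (B * abs (v m - v n))) //.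
    by rewrite ler_wpM2r ?padic_abs_ge0 ?uB.
  by rewrite mulrC -ltr_pdivlMr // vM.
Qed.
End CauchyRing.

HB.instance Definition _ p (pr_p : prime p) :=
  GRing.isSubringClosed.Build (nat -> rat) (padic_cauchy pr_p)
    (padic_cauchy_subring pr_p).

Record padic_seq p (pr_p : prime p) := PadicSeq {
  padic_seq_val :> nat -> rat;
  _ : padic_seq_val \in padic_cauchy pr_p }.

HB.instance Definition _ p (pr_p : prime p) :=
  [isSub for @padic_seq_val p pr_p].
HB.instance Definition _ p (pr_p : prime p) :=
  [Choice of padic_seq pr_p by <:].
HB.instance Definition _ p (pr_p : prime p) :=
  [SubChoice_isSubComNzRing of padic_seq pr_p by <:].

Section PadicSeqTheory.
Variables (p : nat) (pr_p : prime p).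
Implicit Types u v : padic_seq pr_p.

Lemma padic_seq0 n : (0 : padic_seq pr_p) n = 0.
Proof. by rewrite [padic_seq_val _](rmorph0 val). Qed.

Lemma padic_seq1 n : (1 : padic_seq pr_p) n = 1.
Proof. by rewrite [padic_seq_val _](rmorph1 val). Qed.

Lemma padic_seqD u v n : (u + v) n = u n + v n.
Proof. by rewrite [padic_seq_val _](rmorphD val). Qed.

Lemma padic_seqB u v n : (u - v) n = u n - v n.
Proof. by rewrite [padic_seq_val _](rmorphB val). Qed.

Lemma padic_seqM u v n : (u * v) n = u n * v n.
Proof. by rewrite [padic_seq_val _](rmorphM val). Qed.
End PadicSeqTheory.

Definition padic_null p (pr_p : prime p) : {pred padic_seq pr_p} :=
  fun u => `[< forall e : rat, 0 < e -> exists N, forall n,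
    (N <= n)%N -> padic_abs p (u n) < e >].

Section NullIdeal.
Variables (p : nat) (pr_p : prime p).
Local Notation abs := (padic_abs p).
Local Notation null := (@padic_null p pr_p).
Implicit Types u v : padic_seq pr_p.

Lemma padic_nullP u : reflect (forall e : rat, 0 < e -> exists N, forall n,
    (N <= n)%N -> abs (u n) < e) (u \in null).
Proof. exact: asboolP. Qed.

Lemma padic_null_idealr : idealr_closed null.
Proof.
split.
- apply/padic_nullP => e e0; exists 0%N => n _.
  by rewrite padic_seq0 padic_abs0.
- apply/negP => /padic_nullP/(_ 1 ltr01)[N /(_ N (leqnn N))].
  by rewrite padic_seq1 padic_abs1 // ltxx.
- move=> a u v /padic_nullP hu /padic_nullP hv; apply/padic_nullP => e e0.
  have [B B0 [K aB]] := padic_cauchy_bounded (valP a).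
  have [N uN] := hu _ (divr_gt0 e0 B0); have [M vM] := hv e e0.
  exists (maxn K (maxn N M)) => n; rewrite !geq_max => /and3P[? ? ?].
  rewrite padic_seqD padic_seqM.
  rewrite (le_lt_trans (padic_absD pr_p _ _)) // gt_max vM // andbT.
  rewrite padic_absM //.
  rewrite (@le_lt_trans _ _ (B * abs (u n))) //.
    by rewrite ler_wpM2r ?padic_abs_ge0 ?aB.
  by rewrite mulrC -ltr_pdivlMr // uN.
Qed.

Lemma padic_abs_stable u : u \notin null ->
  exists2 c : rat, 0 < c & exists N, forall n, (N <= n)%N -> abs (u n) = c.
Proof.
move=> /padic_nullP nu.
have [e [e0 ue]] : exists e : rat, 0 < e /\
    forall N, exists2 n, (N <= n)%N & e <= abs (u n).
  apply: contrapT => h; apply: nu => e e0; apply: contrapT => hN.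
  apply: h; exists e; split=> // N; apply: contrapT => hn.
  apply: hN; exists N => n Nn; rewrite ltNge; apply/negP => le.
  by apply: hn; exists n.
have [N uN] := padic_cauchyP _ _ (valP u) e e0.
have [n Nn en] := ue N.
exists (abs (u n)); first exact: lt_le_trans en.
exists N => m Nm; apply: (padic_abs_iso pr_p).
by apply: lt_le_trans en; apply: uN.
Qed.
End NullIdeal.

HB.instance Definition _ p (pr_p : prime p) :=
  isIdealr.Build (padic_seq pr_p) (@padic_null p pr_p)
    (padic_null_idealr pr_p).

Definition Qp p (pr_p : prime p) : Type := {ideal_quot (@padic_null p pr_p)}.

HB.instance Definition _ p (pr_p : prime p) := GRing.ComNzRing.on (Qp pr_p).
HB.instance Definition _ p (pr_p : prime p) :=
  NzRingQuotient.on (Qp pr_p).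
HB.instance Definition _ p (pr_p : prime p) := isPointed.Build (Qp pr_p) 0.

Section QpField.
Variables (p : nat) (pr_p : prime p).
Local Notation abs := (padic_abs p).
Local Notation null := (@padic_null p pr_p).
Local Notation pi := (\pi_(Qp pr_p)%qT).
Implicit Types (x y z : Qp pr_p) (u v : padic_seq pr_p).

Lemma Qp_piD u v : pi (u + v) = pi u + pi v.
Proof. exact: (rmorphD pi). Qed.

Lemma Qp_piB u v : pi (u - v) = pi u - pi v.
Proof. exact: (rmorphB pi). Qed.

Lemma Qp_piM u v : pi (u * v) = pi u * pi v.
Proof. exact: (rmorphM pi). Qed.

Lemma Qp_pi_eq0 u : (pi u == 0) = (u \in null).
Proof. by rewrite -[0](rmorph0 pi) -Quotient.idealrBE subr0. Qed.

Definition Qp_inv x : Qp pr_p := xget 0 [set y | y * x = 1].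

Lemma Qp_mulVf x : x != 0 -> Qp_inv x * x = 1.
Proof.
rewrite -[x]reprK; set u : padic_seq pr_p := repr x; rewrite Qp_pi_eq0 => nu.
have [c c0 [N uc]] := padic_abs_stable nu.
have w_cauchy : (fun n => (u n)^-1) \in padic_cauchy pr_p.
  apply/padic_cauchyP => e e0.
  have [M uM] := padic_cauchyP _ _ (valP u) (e * (c * c)) (mulr_gt0 e0 (mulr_gt0 c0 c0)).
  exists (maxn N M) => m n; rewrite !geq_max => /andP[Nm Mm] /andP[Nn Mn].
  have um0 : u m != 0 by rewrite -(padic_abs_gt0 pr_p) uc.
  have un0 : u n != 0 by rewrite -(padic_abs_gt0 pr_p) uc.
  have -> : (u m)^-1 - (u n)^-1 = (u n - u m) / (u m * u n).
    by rewrite mulrBl invfM [X in _ = X - _]mulrCA divff // mulr1 mulrA divff // mul1r.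
  rewrite (padic_absM pr_p) (padic_absV pr_p) (padic_absM pr_p) !uc //.
  by rewrite ltr_pdivrMr ?mulr_gt0 // uM.
pose w := PadicSeq w_cauchy.
suff wu1 : pi w * pi u = 1 by exact: (@xgetPex _ 0 [set y | y * pi u = 1] (ex_intro _ _ wu1)).
apply/eqP; rewrite -subr_eq0 -[1](rmorph1 pi) -Qp_piM -Qp_piB Qp_pi_eq0.
apply/padic_nullP => e e0; exists N => n Nn.
have un0 : u n != 0 by rewrite -(padic_abs_gt0 pr_p) uc.
by rewrite padic_seqB padic_seqM padic_seq1 /= mulVf // subrr padic_abs0.
Qed.

Lemma Qp_inv0 : Qp_inv 0 = 0.
Proof.
rewrite /Qp_inv; case: xgetP => // y _ /eqP; rewrite mulr0 eq_sym.
by rewrite oner_eq0.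
Qed.
End QpField.

HB.instance Definition _ p (pr_p : prime p) :=
  GRing.ComNzRing_isField.Build (Qp pr_p) (@Qp_mulVf p pr_p) (@Qp_inv0 p pr_p).

(* |x|_p is the limit of the p-adic absolute values of a representative of x.
   That sequence is eventually constant or tends to 0, so the limit exists in Q
   and is 0 or an integral power of p; hence a rational-valued norm. *)
Definition Qp_norm p (pr_p : prime p) (x : Qp pr_p) : rat :=
  limn (fun n => padic_abs p ((repr x : padic_seq pr_p) n) : rat^o).

Section QpNorm.
Variables (p : nat) (pr_p : prime p).
Local Notation abs := (padic_abs p).
Local Notation null := (@padic_null p pr_p).
Local Notation norm := (@Qp_norm p pr_p).
Local Notation pi := (\pi_(Qp pr_p)%qT).
Implicit Types (x y z : Qp pr_p) (u v : padic_seq pr_p).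

Lemma Qp_norm0 : norm 0 = 0.
Proof.
have : (repr (0 : Qp pr_p) : padic_seq pr_p) \in null by rewrite -Qp_pi_eq0 reprK.
move=> /padic_nullP h; rewrite /Qp_norm.
apply: (cvg_lim (@norm_hausdorff rat rat^o)).
apply/(@cvgrPdist_lt _ rat^o) => e e0; have [N hN] := h e e0.
exists N => // n /= Nn; rewrite sub0r normrN ger0_norm ?hN //.
exact: padic_abs_ge0.
Qed.

Lemma Qp_norm_stable u : pi u != 0 ->
  0 < norm (pi u) /\ exists N, forall n, (N <= n)%N -> abs (u n) = norm (pi u).
Proof.
move=> u0; have [c c0 [N uc]] : exists2 c : rat, 0 < c & exists N, forall n,
    (N <= n)%N -> abs (u n) = c by apply: padic_abs_stable; rewrite -Qp_pi_eq0.
suff -> : norm (pi u) = c by split=> //; exists N.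
set v : padic_seq pr_p := repr (pi u).
have /padic_nullP/(_ c c0)[M vuM] : v - u \in null.
  by rewrite -Qp_pi_eq0 Qp_piB reprK subrr.
rewrite /Qp_norm.
apply: (cvg_lim (@norm_hausdorff rat rat^o)).
apply: (@cvg_near_cst _ rat^o); exists (maxn N M) => // n /=; rewrite geq_max => /andP[Nn Mn].
rewrite -(uc n Nn); apply: (padic_abs_iso pr_p).
by rewrite (uc n Nn) -padic_seqB vuM.
Qed.

Lemma Qp_norm_gt0 x : (0 < norm x) = (x != 0).
Proof.
have [->|x0] := eqVneq x 0; first by rewrite Qp_norm0 ltxx.
by rewrite -[x]reprK in x0 *; have [] := Qp_norm_stable x0.
Qed.

Lemma Qp_norm_ge0 x : 0 <= norm x.
Proof.
by have [->|] := eqVneq x 0; [rewrite Qp_norm0|rewrite -Qp_norm_gt0 => /ltW].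
Qed.

Lemma Qp_norm0_eq0 x : norm x = 0 -> x = 0.
Proof. by move=> x0; apply/eqP; rewrite -[_ == _]negbK -Qp_norm_gt0 x0 ltxx. Qed.

Lemma Qp_normM x y : norm (x * y) = norm x * norm y.
Proof.
have [->|x0] := eqVneq x 0; first by rewrite mul0r Qp_norm0 mul0r.
have [->|y0] := eqVneq y 0; first by rewrite mulr0 Qp_norm0 mulr0.
have xy0 : x * y != 0 by rewrite mulf_neq0.
rewrite -[x]reprK -[y]reprK -Qp_piM in x0 y0 xy0 *.
have [_ [N hN]] := Qp_norm_stable x0; have [_ [M hM]] := Qp_norm_stable y0.
have [_ [K hK]] := Qp_norm_stable xy0.
pose n := maxn N (maxn M K).
rewrite -(hN n) ?leq_maxl // -(hM n) ?leq_max ?leqnn ?orbT //.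
rewrite -(hK n) ?leq_max ?leqnn ?orbT //.
by rewrite padic_seqM (padic_absM pr_p).
Qed.

Lemma Qp_normD x y : norm (x + y) <= Num.max (norm x) (norm y).
Proof.
have [->|x0] := eqVneq x 0; first by rewrite add0r le_max lexx orbT.
have [->|y0] := eqVneq y 0; first by rewrite addr0 le_max lexx.
have [->|xy0] := eqVneq (x + y) 0.
  by rewrite Qp_norm0 le_max Qp_norm_ge0.
rewrite -[x]reprK -[y]reprK -Qp_piD in x0 y0 xy0 *.
have [_ [N hN]] := Qp_norm_stable x0; have [_ [M hM]] := Qp_norm_stable y0.
have [_ [K hK]] := Qp_norm_stable xy0.
pose n := maxn N (maxn M K).
rewrite -(hN n) ?leq_maxl // -(hM n) ?leq_max ?leqnn ?orbT //.
rewrite -(hK n) ?leq_max ?leqnn ?orbT //.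
by rewrite padic_seqD (padic_absD pr_p).
Qed.

Lemma Qp_normN x : norm (- x) = norm x.
Proof.
have [->|x0] := eqVneq x 0; first by rewrite oppr0.
have n1 : norm (-1) = 1.
  have /eqP : norm (-1) ^+ 2 = 1 ^+ 2.
    have /eqP : norm 1 * norm 1 = norm 1 * 1 by rewrite -Qp_normM !mulr1.
    have n10 : norm 1 != 0 by rewrite lt0r_neq0 // Qp_norm_gt0 oner_eq0.
    by move=> /eqP/(mulfI n10) h1; rewrite expr2 -Qp_normM mulrNN mulr1 h1 expr1n.
  by rewrite eqrXn2 ?Qp_norm_ge0 // => /eqP.
by rewrite -mulN1r Qp_normM n1 mul1r.
Qed.

Definition Qp_dist x y := norm (x - y).

Lemma Qp_distxx x : Qp_dist x x = 0.
Proof. by rewrite /Qp_dist subrr Qp_norm0. Qed.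

Lemma Qp_dist_positivity x y : Qp_dist x y = 0 -> x = y.
Proof. by move=> /Qp_norm0_eq0/eqP; rewrite subr_eq0 => /eqP. Qed.

Lemma Qp_dist_sym x y : Qp_dist x y = Qp_dist y x.
Proof. by rewrite /Qp_dist -Qp_normN opprB. Qed.

Lemma Qp_dist_triangle y x z : Qp_dist x z <= Qp_dist x y + Qp_dist y z.
Proof.
rewrite /Qp_dist -[X in norm (X - z)](subrK y) -addrA.
apply: le_trans (Qp_normD _ _) _.
by rewrite ge_max lerDl lerDr !Qp_norm_ge0.
Qed.
End QpNorm.

HB.instance Definition _ p (pr_p : prime p) :=
  isMetric.Build rat (Qp pr_p) (@Qp_distxx p pr_p) (@Qp_dist_positivity p pr_p)
    (@Qp_dist_sym p pr_p) (@Qp_dist_triangle p pr_p).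

Definition Qp_sphere p (pr_p : prime p) (a : Qp pr_p) (r : rat) : set (Qp pr_p) :=
  [set x | Qp_norm (x - a) = r].

Definition Qp_isometry p (pr_p : prime p) (a : Qp pr_p) (r : rat)
    (f : Qp_sphere a r -> Qp_sphere a r) :=
  forall x y, Qp_norm (val (f x) - val (f y)) = Qp_norm (val x - val y).

(* Main.v *)
Require Import Defs.
From mathcomp Require Import all_boot all_order all_algebra.
From mathcomp Require Import all_classical topology normedtype.
Import Order.TTheory GRing.Theory Num.Theory.
Local Open Scope classical_set_scope.
Local Open Scope ring_scope.

(** An isometry moves all points of an orbit by the same amount:
    |f^(n+1)(x) - f^n(x)|_p = |f(x) - x|_p for every n ([isometry_orbit_step]).
    If x is not fixed, this common value is positive, whereas the distance
    between consecutive terms of a convergent sequence tends to 0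
    ([cvg_ball_step]). *)

(** Two consecutive terms eventually lie within e / 2 of the limit; a single
    such pair suffices when the step is constant. *)
Lemma cvg_ball_step {R : numFieldType} {M : pseudoMetricType R} (u : nat -> M)
    (l : M) (e : R) :
  u @ \oo --> l -> 0 < e -> exists n, ball (u n.+1) e (u n).
Proof.
move=> ul e_gt0.
have [N _ near_l] := (cvg_ballP _ _).1 ul (e / 2) (divr_gt0 e_gt0 (ltr0Sn _ _)).
by exists N; apply: (ball_splitr (z := l)); apply: near_l => /=.
Qed.

Lemma isometry_orbit_step (p : nat) (pr_p : prime p) (a : Qp pr_p) (r : rat)
    (f : Qp_sphere a r -> Qp_sphere a r) (f_iso : Qp_isometry f)
    (x : Qp_sphere a r) (n : nat) :
  Qp_norm (val (iter n.+1 f x) - val (iter n f x)) =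
  Qp_norm (val (f x) - val x).
Proof. by elim: n => //= n IHn; rewrite f_iso. Qed.

Theorem proposition1 (p : nat) (pr_p : prime p) (a : Qp pr_p) (r : rat)
  (hr : exists m : int, r = p%:R ^ m)
  (f : Qp_sphere a r -> Qp_sphere a r) (f_iso : Qp_isometry f)
  (x : Qp_sphere a r) :
  f x <> x -> ~ cvgn (fun n : nat => val (iter n f x) : Qp pr_p).
Proof.
move=> fx_neq orbit_cvg.
have step_gt0 : 0 < Qp_norm (val (f x) - val x).
  by rewrite Qp_norm_gt0 subr_eq0; apply/eqP => /val_inj.
have [n] := cvg_ball_step _ _ _ orbit_cvg step_gt0.
by rewrite ballEmdist /= -[mdist _ _]/(Qp_norm _) isometry_orbit_step // ltxx.
Qed.
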